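(* Let $M=(X,P,v)$ be an expertise model and let $R_P$ be the relation on $X$ defined by $x R_P y$ iff $A_x = A_y$, where $A_x=\bigcap\{A\in P\mid x\in A\}$. Then $M^*=(X,R_P,v)$ is an S5 model (i.e. $R_P$ is an equivalence relation), and for every $x\in X$ and every $\phi\in\mathcal{L}$, $$M,x\vDash\phi \iff M^*,x\vDash t(\phi).$$
   Context: Let $\mathsf{Prop}$ be a countable set of propositional variables. The language $\mathcal{L}$ is given by $\phi ::= p \mid \neg\phi \mid \phi\wedge\phi \mid \mathsf{E}\phi \mid \mathsf{S}\phi \mid \mathsf{A}\phi$. An expertise frame is $(X,P)$ with $P\subseteq 2^X$ satisfying (P1) $X\in P$, (P2) closure under complement in $X$, (P3) closure under arbitrary intersections; an expertise model $M=(X,P,v)$ adds a valuation $v:\mathsf{Prop}\to 2^X$. Satisfaction in expertise models: atoms and Boolean connectives standard; $M,x\vDash\mathsf{E}\phi$ iff $\|\phi\|_M\in P$; $M,x\vDash\mathsf{S}\phi$ iff for all $A\in P$, $\|\phi\|_M\subseteq A$ implies $x\in A$; $M,x\vDash\mathsf{A}\phi$ iff $M,y\vDash\phi$ for all $y\in X$; $\|\phi\|_M=\{x\mid M,x\vDash\phi\}$. The language $\mathcal{L}_{\mathsf{K}\mathsf{A}}$ is $\phi ::= p\mid\neg\phi\mid\phi\wedge\phi\mid\mathsf{K}\phi\mid\mathsf{A}\phi$. A relational model is $(X,R,v)$ with $R\subseteq X\times X$; it is an S5 model if $R$ is an equivalence relation. Relational satisfaction: Boolean clauses standard; $x\vDash\mathsf{K}\phi$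 iff $y\vDash\phi$ for all $y$ with $xRy$; $x\vDash\mathsf{A}\phi$ iff $y\vDash\phi$ for all $y\in X$. The translation $t:\mathcal{L}\to\mathcal{L}_{\mathsf{K}\mathsf{A}}$ is defined by $t(p)=p$, $t(\neg\phi)=\neg t(\phi)$, $t(\phi\wedge\psi)=t(\phi)\wedge t(\psi)$, $t(\mathsf{A}\phi)=\mathsf{A}t(\phi)$, $t(\mathsf{E}\phi)=\mathsf{A}(t(\phi)\rightarrow\mathsf{K}t(\phi))$, $t(\mathsf{S}\phi)=\neg\mathsf{K}\neg t(\phi)$. *)

(* Defs.v *)
From mathcomp Require Import all_boot.
From mathcomp Require Import boolp classical_sets.
From Corelib Require Import Relation_Definitions.

Set Implicit Arguments.
Unset Strict Implicit.
Unset Printing Implicit Defensive.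

Local Open Scope classical_set_scope.

(* The language of expertise (E), soundness (S) and the universal modality. *)
Inductive form (Atom : Type) : Type :=
| Var of Atom
| Neg of form Atom
| And of form Atom & form Atom
| Exp of form Atom
| Snd of form Atom
| All of form Atom.

Record expertise_frame (X : Type) := ExpertiseFrame {
  expertise : set (set X);
  expertiseT : expertise setT;
  expertiseC : forall A, expertise A -> expertise (~` A);
  expertise_bigcap : forall F : set (set X),
    F `<=` expertise -> expertise (\bigcap_(A in F) A) }.

Record expertise_model (Atom X : Type) := ExpertiseModel {
  eframe :> expertise_frame X;
  evaluation : Atom -> set X }.

Fixpoint esat (Atom X : Type) (M : expertise_model Atom X) (x : X)
    (phi : form Atom) {struct phi} : Prop :=
  match phi with
  | Var p => evaluation M p x
  | Neg psi => ~ esat M x psi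
  | And psi chi => esat M x psi /\ esat M x chi
  | Exp psi => expertise M [set y | esat M y psi]
  | Snd psi => forall A, expertise M A -> [set y | esat M y psi] `<=` A -> A x
  | All psi => forall y, esat M y psi
  end.

(* The language of knowledge (K) and the universal modality. *)
Inductive kform (Atom : Type) : Type :=
| KVar of Atom
| KNeg of kform Atom
| KAnd of kform Atom & kform Atom
| KKnow of kform Atom
| KAll of kform Atom.

(* Implication is not primitive: it abbreviates ~ (phi /\ ~ psi). *)
Definition KImp (Atom : Type) (phi psi : kform Atom) : kform Atom :=
  KNeg (KAnd phi (KNeg psi)).

Record relational_model (Atom X : Type) := RelationalModel {
  accessible : relation X;
  kvaluation : Atom -> set X }.

Definition is_S5 (Atom X : Type) (N : relational_model Atom X) : Prop :=
  equivalence X (accessible N).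

Fixpoint ksat (Atom X : Type) (N : relational_model Atom X) (x : X)
    (phi : kform Atom) {struct phi} : Prop :=
  match phi with
  | KVar p => kvaluation N p x
  | KNeg psi => ~ ksat N x psi
  | KAnd psi chi => ksat N x psi /\ ksat N x chi
  | KKnow psi => forall y, accessible N x y -> ksat N y psi
  | KAll psi => forall y, ksat N y psi
  end.

Fixpoint translate (Atom : Type) (phi : form Atom) : kform Atom :=
  match phi with
  | Var p => KVar p
  | Neg psi => KNeg (translate psi)
  | And psi chi => KAnd (translate psi) (translate chi)
  | Exp psi => KAll (KImp (translate psi) (KKnow (translate psi)))
  | Snd psi => KNeg (KKnow (KNeg (translate psi)))
  | All psi => KAll (translate psi)
  end.

Definition expertise_cell (X : Type) (P : set (set X)) (x : X) : set X :=
  \bigcap_(A in [set A | P A /\ A x]) A.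

Definition expertise_rel (X : Type) (P : set (set X)) : relation X :=
  fun x y => expertise_cell P x = expertise_cell P y.

Definition star (Atom X : Type) (M : expertise_model Atom X) :
    relational_model Atom X :=
  RelationalModel (expertise_rel (expertise M)) (evaluation M).

(* Main.v *)
Require Import Defs.
From mathcomp Require Import all_boot.
From mathcomp Require Import boolp classical_sets.
From Corelib Require Import Relation_Definitions.

(** Closure under complements and intersections makes every cell [A_x] a member
    of [P], and distinct cells disjoint, so [A_x] is the class of [x] for [R_P].
    Hence [P] is exactly the family of [R_P]-saturated sets, which gives the
    clause for [E], and the least member of [P] containing a set is its
    [R_P]-saturation, which gives the clause for [S]. *)

Local Open Scope classical_set_scope.

Lemma expertise_rel_equivalence (X : Type) (P : set (set X)) :
  equivalence X (expertise_rel P).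
Proof. by split=> [x|x y z xy yz|x y xy]; [|exact: etrans yz|exact: esym]. Qed.

Lemma expertise_cell_refl (X : Type) (P : set (set X)) (x : X) :
  expertise_cell P x x.
Proof. by move=> A [_]. Qed.

Lemma expertise_cell_sub (X : Type) (P : set (set X)) (A : set X) (x : X) :
  P A -> A x -> expertise_cell P x `<=` A.
Proof. by move=> PA Ax y; apply. Qed.

Lemma expertise_rel_saturated (X : Type) (P : set (set X)) (A : set X) (x y : X) :
  P A -> A x -> expertise_rel P x y -> A y.
Proof.
move=> PA Ax xy; apply: (expertise_cell_sub _ _ _ _ PA Ax).
by rewrite xy; exact: expertise_cell_refl.
Qed.

Section ExpertiseFrame.
Variables (X : Type) (F : expertise_frame X).
Local Notation P := (@expertise X F).

Lemma expertise_cell_expertise (x : X) : P (expertise_cell P x).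
Proof. by apply: expertise_bigcap => A []. Qed.

(** Closure under complement makes cell membership symmetric: if [x] lay outside the cell of [y],
    the complement of that cell would contain the cell of [x], hence [y]. Minimality of cells then
    gives both inclusions. *)
Lemma expertise_cellP (x y : X) : expertise_cell P x y <-> expertise_rel P x y.
Proof.
split=> [xy|->]; last exact: expertise_cell_refl.
have Pyc := expertiseC (expertise_cell_expertise y).
have yx : expertise_cell P y x.
  apply: contrapT => nyx.
  exact: (expertise_cell_sub _ _ _ _ Pyc nyx _ xy) (expertise_cell_refl _ _ _).
by apply/seteqP; split; apply: expertise_cell_sub => //;
  exact: expertise_cell_expertise.
Qed.

Lemma expertise_saturatedP (A : set X) :
  P A <-> forall x, A x -> forall y, expertise_rel P x y -> A y.
Proof.
split=> [PA x Ax y|satA]; first exact: expertise_rel_saturated.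
(* A saturated set is the union of the cells of its points, put in De Morgan form to fit the closure
   axioms of [P]. *)
suff -> : A = ~` \bigcap_(B in [set ~` expertise_cell P x | x in A]) B.
  apply/expertiseC/expertise_bigcap => _ [x _ <-].
  exact/expertiseC/expertise_cell_expertise.
apply/seteqP; split=> y.
  by move=> Ay /(_ (~` expertise_cell P y)); apply;
    [exists y | exact: expertise_cell_refl].
move=> nAy; apply: contrapT => Ay; apply: nAy => _ [x Ax <-] /expertise_cellP xy.
exact/Ay/satA/xy.
Qed.

(** If no point of [A] is related to [x], the complement of the cell of [x] is a member of [P] that
    includes [A] but misses [x]. *)
Lemma expertise_hullP (A : set X) (x : X) :
  (forall B, P B -> A `<=` B -> B x) <-> exists2 y, expertise_rel P x y & A y.
Proof.
split=> [hullx|[y xy Ay] B PB AB]; last first.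
  exact: expertise_rel_saturated PB (AB y Ay) (esym xy).
apply: contrapT => nA.
apply: (hullx (~` expertise_cell P x)); last exact: expertise_cell_refl.
  exact/expertiseC/expertise_cell_expertise.
by move=> y Ay /expertise_cellP xy; apply: nA; exists y.
Qed.

End ExpertiseFrame.

Lemma ksat_KImp (Atom X : Type) (N : relational_model Atom X) (x : X)
    (phi psi : kform Atom) :
  ksat N x (KImp phi psi) <-> (ksat N x phi -> ksat N x psi).
Proof.
split=> /= [nn phix|imp [phix npsi]]; last exact/npsi/imp.
by apply: contrapT => npsi; apply: nn.
Qed.

Theorem theorem1 (Atom : countType) (X : Type) (M : expertise_model Atom X) :
  is_S5 (star M) /\
  forall (x : X) (phi : form Atom),
    esat M x phi <-> ksat (star M) x (translate phi).
Proof.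
split=> [|x phi]; first exact: expertise_rel_equivalence.
(* [Exp] and [Snd] depend on the whole truth set, so the induction hypothesis is needed at all
   points, as an equality of sets. *)
have extE psi : (forall y, esat M y psi <-> ksat (star M) y (translate psi)) ->
    [set y | esat M y psi] = [set y | ksat (star M) y (translate psi)].
  by move=> IH; apply/seteqP; split=> y /IH.
elim: phi x => [p|psi IH|psi IHpsi chi IHchi|psi IH|psi IH|psi IH] x.
- by [].
- by rewrite /= IH.
- by rewrite /= IHpsi IHchi.
- rewrite [esat _ _ _]/= extE // expertise_saturatedP.
  by split=> sat y; [exact: (ksat_KImp _ _ _ _ _ (KKnow _)).2 (sat y)
                   | exact: (ksat_KImp _ _ _ _ _ (KKnow _)).1 (sat y)].
- rewrite [esat _ _ _]/= extE // expertise_hullP /=.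
  (* The dual of [KKnow] is classically the existential of [expertise_hullP]. *)
  split=> [[y xy psiy] /(_ y xy)|nK]; first exact.
  by apply: contrapT => nex; apply: nK => y xy psiy; apply: nex; exists y.
- by split=> sat y; apply/IH; exact: sat.
Qed.
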